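(* Let $q=p^m$ be a power of a prime $p$, let $G\in\mathbb{F}_q[x]$, and let $n,r$ be positive integers such that $d:=(m,r)=(mn,r)$, $p\nmid n$ and $(n,p^{(m,r)}-1)=1$. Then \[f(x)=ax^{p^r}+x\left(G(T_{q^n|q}(x))-aT_{q^n|q}(x)^{p^r-1}\right)\] is a complete permutation polynomial over $\mathbb{F}_{q^n}$ for each $a\in\mathbb{F}_q^*$ if and only if $xG(x)$ is a complete permutation polynomial over $\mathbb{F}_q$.
   Context: $T_{q^n|q}(x)=\sum_{i=0}^{n-1}x^{q^i}$ is the trace from $\mathbb{F}_{q^n}$ to $\mathbb{F}_q$. A polynomial $h$ is a complete permutation polynomial (complete mapping) over a finite field $K$ if both $h(x)$ and $h(x)+x$ induce permutations of $K$. *)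

(* Defs.v *)
From HB Require Import structures.
From mathcomp Require Import all_boot all_order all_algebra.

Set Implicit Arguments.
Unset Strict Implicit.
Unset Printing Implicit Defensive.

Import GRing.Theory.
Local Open Scope ring_scope.

Definition permutation_poly (K : finFieldType) (h : {poly K}) : Prop :=
  bijective (fun x : K => h.[x]).

Definition complete_permutation_poly (K : finFieldType) (h : {poly K}) : Prop :=
  permutation_poly h /\ permutation_poly (h + 'X).

(* T_{q^n|q}(x) as a polynomial with coefficients in F_q; its values on the
   degree-n extension are those of its image in {poly L}. *)
Definition trace_poly (F : finFieldType) (q n : nat) : {poly F} :=
  \sum_(i < n) 'X^(q ^ i).

(* Since a and G are over F_q, this lies in F_q[x]; G \Po T is G(T(x)). *)
Definition cpp_family (F : finFieldType) (p m n r : nat) (G : {poly F}) (a : F)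
    : {poly F} :=
  let T := trace_poly F (p ^ m) n in
  a *: 'X^(p ^ r) + 'X * (G \Po T - a *: T ^+ (p ^ r - 1)).

(* Main.v *)
(* On F_{q^n} one has T(f(x)) = h(T(x)) with h = xG, and T maps onto F_q, so f
   permutes F_{q^n} iff h permutes F_q and f is injective on each fibre of T.
   On each fibre f agrees with an additive polynomial, so a collision yields z with
   T(z) = 0 and z^(p^r) = c z for some c in F_q.  If z <> 0, then
   y = z^(q-1) satisfies y^(p^r-1) = 1 and y^(q^n-1) = 1, so y^(p^d-1) = 1 with
   d = (mn,r) = (m,r); thus y lies in F_q and z = z^(q^n) = z y^n gives y^n = 1,
   whence y = 1.  So z is in F_q and T(z) = n z <> 0, a contradiction.
   Completeness is free because f + x is the polynomial attached to G + 1. *)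
Require Import Defs.
From HB Require Import structures.
From mathcomp Require Import all_boot all_order all_algebra.
From mathcomp Require Import finfield.

Set Implicit Arguments.
Unset Strict Implicit.
Unset Printing Implicit Defensive.

Import GRing.Theory.
Local Open Scope ring_scope.

Lemma surjF_bij (T : finType) (f : T -> T) :
  (forall y, exists x, f x = y) -> bijective f.
Proof.
move=> /fin_all_exists[g gK].
exact: bij_can_bij (injF_bij (can_inj gK)) _ gK.
Qed.

(** Bezout in the form [km * a = kn * b + gcdn a b] keeps all exponents nonnegative, so [x] is never
    inverted. *)
Lemma expr_gcdn_eq1 (R : pzRingType) (x : R) (a b : nat) :
  x ^+ a = 1 -> x ^+ b = 1 -> x ^+ gcdn a b = 1.
Proof.
case: a => [|a] xa xb; first by rewrite gcd0n.
have [km kn eqk _] := egcdnP b (ltn0Sn a).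
have : x ^+ (km * a.+1) = 1 by rewrite mulnC exprM xa expr1n.
by rewrite eqk exprD mulnC exprM xb expr1n mul1r.
Qed.

Lemma expr_iter_expn (R : pzRingType) (x : R) (q k : nat) :
  x ^+ q = x -> x ^+ (q ^ k) = x.
Proof. by move=> xq; elim: k => [|k IHk]; rewrite ?expr1 // expnS exprM xq. Qed.

(** The same Bezout relation, now counting iterates of the map [x -> x ^+ p]. *)
Lemma expr_expn_gcdn (R : pzRingType) (x : R) (p a b : nat) :
  x ^+ (p ^ a) = x -> x ^+ (p ^ b) = x -> x ^+ (p ^ gcdn a b) = x.
Proof.
case: a => [|a] xa xb; first by rewrite gcd0n.
have [km kn eqk _] := egcdnP b (ltn0Sn a).
have : x ^+ (p ^ (km * a.+1)) = x by rewrite mulnC expnM expr_iter_expn.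
by rewrite eqk expnD exprM mulnC expnM (expr_iter_expn kn xb).
Qed.

Definition trace_map (R : pzRingType) (q n : nat) (x : R) : R :=
  \sum_(i < n) x ^+ (q ^ i).

Lemma trace_mapD (R : comNzRingType) (q n : nat) (x y : R) :
  [pchar R].-nat q ->
  trace_map q n (x + y) = trace_map q n x + trace_map q n y.
Proof.
move=> charq; rewrite -big_split; apply: eq_bigr => i _.
by rewrite exprDn_pchar // pnatX charq.
Qed.

Lemma trace_mapX (R : comNzRingType) (q n e : nat) (x : R) :
  [pchar R].-nat e -> trace_map q n (x ^+ e) = trace_map q n x ^+ e.
Proof.
move=> chare; have e_gt0 : (0 < e)%N by case/andP: chare.
rewrite /trace_map; elim: n => [|n IHn].
  by rewrite !big_ord0 expr0n -(prednK e_gt0).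
by rewrite !big_ord_recr exprDn_pchar //= IHn exprAC.
Qed.

Lemma trace_mapZ (R : comPzRingType) (q n : nat) (c x : R) :
  c ^+ q = c -> trace_map q n (c * x) = c * trace_map q n x.
Proof.
move=> cq; rewrite mulr_sumr; apply: eq_bigr => i _.
by rewrite exprMn (expr_iter_expn i cq).
Qed.

Lemma trace_map_fixed (R : pzRingType) (q n : nat) (x : R) :
  x ^+ q = x -> trace_map q n x = x *+ n.
Proof.
move=> xq; rewrite /trace_map.
under eq_bigr do rewrite expr_iter_expn //.
by rewrite sumr_const card_ord.
Qed.

(** The [q]-th power shifts the summands cyclically: adding [x] to either side gives the sum of the
    first [n.+1] conjugates. *)
Lemma trace_map_expr (R : comNzRingType) (q n : nat) (x : R) :
  [pchar R].-nat q -> x ^+ (q ^ n) = x ->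
  trace_map q n x ^+ q = trace_map q n x.
Proof.
move=> charq xqn; rewrite -trace_mapX //; apply: (addrI x).
have -> : x + trace_map q n x = \sum_(i < n.+1) x ^+ (q ^ i).
  by rewrite big_ord_recr /= xqn addrC.
rewrite big_ord_recl; congr (_ + _); apply: eq_bigr => i _.
by rewrite -exprM -expnS.
Qed.

(** Evaluating the image of X^|F| - X = prod (X - u) at [x] gives a vanishing product in a domain,
    so some factor [x - iota u] is zero. *)
Lemma finField_fixed_codom (F : finFieldType) (R : idomainType)
    (iota : {rmorphism F -> R}) (x : R) :
  x ^+ #|F| = x -> exists u, x = iota u.
Proof.
move=> xF; have := congr1 (fun P => (map_poly iota P).[x]) (finField_genPoly F).
rewrite rmorphB rmorph_prod /= map_polyXn map_polyX !hornerE xF subrr.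
move/esym/eqP; rewrite horner_prod => /prodf_eq0[u _].
by rewrite rmorphB /= map_polyX map_polyC !hornerE subr_eq0 => /eqP; exists u.
Qed.

Lemma trace_map_ker (p m n r : nat) (K : fieldType) (c z : K) :
  (0 < p)%N -> n%:R != 0 :> K ->
  gcdn m r = gcdn (m * n) r -> coprime n (p ^ gcdn m r - 1) ->
  z ^+ ((p ^ m) ^ n) = z -> c ^+ (p ^ m) = c -> z ^+ (p ^ r) = c * z ->
  trace_map (p ^ m) n z = 0 -> z = 0.
Proof.
move=> p_gt0 n_neq0 gcd_eq n_coprime zL cF zc trz.
have [//|z_neq0] := eqVneq z 0.
have c_neq0 : c != 0.
  apply: contraNneq z_neq0 => c0; move/eqP: zc.
  by rewrite c0 mul0r expf_eq0 => /andP[].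
have exprX_eq1 (x : K) (k : nat) : x != 0 -> x ^+ k = x -> x ^+ (k - 1) = 1.
  case: k => [|k] x_neq0 xk; first by rewrite expr0.
  by apply: (mulfI x_neq0); rewrite subn1 -exprS xk mulr1.
have pm_gt0 : (0 < p ^ m)%N by rewrite expn_gt0 p_gt0.
pose y := z ^+ (p ^ m - 1).
have y_neq0 : y != 0 by rewrite expf_neq0.
have zq : z ^+ (p ^ m) = z * y by rewrite /y -exprS subn1 prednK.
(* Raise [zc] to the power q - 1; the factor [c] disappears because c^(q-1) = 1. *)
have yr : y ^+ (p ^ r) = y.
  by rewrite /y exprAC zc exprMn (exprX_eq1 _ _ c_neq0 cF) mul1r.
have yd : y ^+ (p ^ gcdn m r) = y.
  by rewrite gcd_eq expr_expn_gcdn // /y exprAC expnM zL.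
have ym : y ^+ (p ^ m) = y.
  by have /dvdnP[k ->] := dvdn_gcdl m r; rewrite mulnC expnM expr_iter_expn //.
(* Each [q]-th power fixes [y] and turns [z] into [z * y]. *)
have zi i : z ^+ ((p ^ m) ^ i) = z * y ^+ i.
  elim: i => [|i IHi]; first by rewrite mulr1.
  by rewrite expnSr exprM IHi exprMn zq exprAC ym exprS mulrA.
have yn : y ^+ n = 1 by apply: (mulfI z_neq0); rewrite -zi zL mulr1.
have y1 : y = 1.
  rewrite -[y]expr1 -[X in y ^+ X](eqP n_coprime).
  exact: expr_gcdn_eq1 yn (exprX_eq1 _ _ y_neq0 yd).
move/eqP: trz; rewrite trace_map_fixed ?zq ?y1 ?mulr1 // -mulr_natr mulf_eq0.
by rewrite (negPf n_neq0) orbF => /eqP.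
Qed.

(** Stated for arbitrary [G], so that it applies to both [G] and [G + 1]. *)
Lemma permutation_poly_cpp_family (p m n r : nat) (F L : finFieldType)
    (iota : {rmorphism F -> L}) (G : {poly F}) (a : F) :
  prime p -> #|F| = (p ^ m)%N -> #|L| = ((p ^ m) ^ n)%N ->
  gcdn m r = gcdn (m * n) r -> ~~ (p %| n)%N ->
  coprime n (p ^ gcdn m r - 1) -> a != 0 ->
  permutation_poly (map_poly iota (cpp_family p m n r G a)) <->
  permutation_poly ('X * G).
Proof.
move=> p_prime cardF cardL gcd_eq p_ndvd_n n_coprime a_neq0.
have p_gt0 := prime_gt0 p_prime.
have charF : p \in [pchar F] := card_finPcharP cardF p_prime.
have charL : p \in [pchar L] := rmorph_pchar iota charF.
have charLX k : [pchar L].-nat (p ^ k)%N.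
  by rewrite pnatX (eq_pnat _ (pcharf_eq charL)) pnat_id.
have nL : n%:R != 0 :> L by rewrite -(dvdn_pcharf charL).
have nF : n%:R != 0 :> F by rewrite -(dvdn_pcharf charF).
have iotaq (u : F) : iota u ^+ (p ^ m) = iota u.
  by rewrite -rmorphXn -cardF expf_card.
have Lqn (x : L) : x ^+ ((p ^ m) ^ n) = x by rewrite -cardL expf_card.
pose T := trace_map (R := L) (p ^ m) n.
pose f (x : L) := iota a * x ^+ (p ^ r)
  + x * ((map_poly iota G).[T x] - iota a * T x ^+ (p ^ r - 1)).
pose h (u : F) := u * G.[u].
have fE x : (map_poly iota (cpp_family p m n r G a)).[x] = f x.
  have TE : (map_poly iota (trace_poly F (p ^ m) n)).[x] = T x.
    rewrite rmorph_sum horner_sum; apply: eq_bigr => i _.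
    by rewrite /= map_polyXn hornerXn.
  rewrite /cpp_family rmorphD rmorphM rmorphB /= !map_polyZ /=.
  by rewrite !rmorphXn /= !map_polyX map_comp_poly !hornerE horner_comp TE.
have hE u : ('X * G).[u] = h u by rewrite !hornerE.
have codomT x : exists u, T x = iota u.
  by apply: finField_fixed_codom; rewrite cardF trace_map_expr.
have Tiota u : T (iota u) = iota (u *+ n).
  by rewrite /T trace_map_fixed // rmorphMn.
have Tf x u : T x = iota u -> T (f x) = iota (h u).
  move=> Txu; rewrite /f Txu horner_map -rmorphXn -rmorphM -rmorphB /=.
  rewrite mulrC [x * _]mulrC /T trace_mapD // mulrC !trace_mapZ //.
  rewrite trace_mapX // -/(T x) Txu -rmorphXn -!rmorphM -rmorphD /=.
  (* Since u^(p^r-1) u = u^(p^r), the two terms with coefficient [a] cancel, leaving u G(u). *)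
  congr (iota _); rewrite /h mulrBl -mulrA -exprSr subn1 prednK ?expn_gt0 ?p_gt0 //.
  by rewrite addrC subrK mulrC.
split=> [f_bij|h_bij].
  have [g _ gK] := f_bij.
  (* The element u/n of F_q has trace [u]; the trace [v] of its preimage under [f] is then a
     preimage of [u] under [h]. *)
  apply: surjF_bij => u; have [v Tv] := codomT (g (iota (u / n%:R))).
  exists v; rewrite hE; apply: (fmorph_inj iota).
  by rewrite -(Tf _ _ Tv) -fE gK Tiota -mulr_natr divfK.
apply: injF_bij => x y; rewrite !fE => fxy.
have [u Tx] := codomT x; have [v Ty] := codomT y.
have huv : u = v.
  apply: (bij_inj h_bij); rewrite !hE; apply: (fmorph_inj iota).
  by rewrite -(Tf _ _ Tx) -(Tf _ _ Ty) fxy.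
rewrite -{}huv in Ty.
pose z := x - y; have xyz : x = y + z by rewrite addrC subrK.
have Tz : T z = 0.
  by apply: (addrI (T y)); rewrite -trace_mapD // -xyz -/(T x) Tx Ty addr0.
suff /eqP : z = 0 by rewrite subr_eq0 => /eqP.
(* Subtracting f(y) from f(x) at common trace [u] leaves a z^(p^r) + z (G(u) - a u^(p^r-1)) = 0;
   solving for z^(p^r) gives this [c]. *)
pose c := u ^+ (p ^ r - 1) - G.[u] / a.
apply: (@trace_map_ker p m n r L (iota c)) => //.
have ia_neq0 : iota a != 0 by rewrite fmorph_eq0.
move: fxy; rewrite /f Tx Ty xyz exprDn_pchar //.
rewrite horner_map -rmorphXn -rmorphM -rmorphB /=.
rewrite mulrDr mulrDl addrACA -[RHS]addr0 => /addrI/eqP.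
rewrite addr_eq0 => /eqP zc.
have kc : a * c = - (G.[u] - a * u ^+ (p ^ r - 1)).
  by rewrite opprB mulrBr mulrCA divff // mulr1.
by apply: (mulfI ia_neq0); rewrite zc mulrA -rmorphM kc rmorphN mulNr mulrC.
Qed.

(* F = F_q and L = F_{q^n}, with F embedded in L by iota *)
Theorem theorem3p4 (p m n r : nat) (F L : finFieldType)
    (iota : {rmorphism F -> L}) (G : {poly F})
    (p_prime : prime p) (m_gt0 : (0 < m)%N)
    (n_gt0 : (0 < n)%N) (r_gt0 : (0 < r)%N)
    (cardF : #|F| = (p ^ m)%N) (cardL : #|L| = ((p ^ m) ^ n)%N)
    (gcd_eq : gcdn m r = gcdn (m * n) r)
    (p_ndvd_n : ~~ (p %| n)%N)
    (n_coprime : coprime n (p ^ gcdn m r - 1)) :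
  (forall a : F, a != 0 ->
     complete_permutation_poly (map_poly iota (cpp_family p m n r G a)))
  <-> complete_permutation_poly ('X * G).
Proof.
have perm (H : {poly F}) (a : F) : a != 0 ->
    permutation_poly (map_poly iota (cpp_family p m n r H a)) <->
    permutation_poly ('X * H).
  exact: permutation_poly_cpp_family.
have addX (a : F) : map_poly iota (cpp_family p m n r G a) + 'X
    = map_poly iota (cpp_family p m n r (G + 1) a).
  rewrite -[X in _ + X](map_polyX iota) -rmorphD /= /cpp_family.
  rewrite comp_polyD comp_polyC polyC1 (addrAC (G \Po _)).
  by rewrite [in RHS]mulrDr mulr1 addrA.
have hX : 'X * G + 'X = 'X * (G + 1) by rewrite mulrDr mulr1.
rewrite /complete_permutation_poly hX; split=> [fP | [h1 h2] a a_neq0].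
  (* The family is instantiated at [a = 1], with [G] for f and [G + 1] for f + x. *)
  have [f1 f2] := fP 1 (oner_neq0 F); rewrite addX in f2.
  by split; [apply/(perm G 1) | apply/(perm (G + 1) 1)]; rewrite ?oner_neq0.
by rewrite addX; split; apply/perm.
Qed.
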